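(* For any partition $\mathbb{N}=S_+\cup S_-$ into two disjoint sets there exists $E\subset\mathbb{N}$ such that the densities $d(E)$ and $d(E\cap(E-n))$, $n\in\mathbb{N}$, exist and (i) $d(E\cap(E-n))>d(E)^2$ for every $n\in S_+$; (ii) $d(E\cap(E-n))<d(E)^2$ for every $n\in S_-$; (iii) $\lim_{n\to\infty}d(E\cap(E-n))=d(E)^2$.
   Context: $\mathbb{N}=\{1,2,\ldots\}$; one of $S_+,S_-$ is allowed to be empty. For $E\subset\mathbb{N}$, $d(E)=\lim_{N\to\infty}\frac{1}{N}|E\cap\{1,\ldots,N\}|$ is the (natural) density of $E$, and writing $d(E)$ implicitly asserts that the limit exists. $E-n=\{m-n\colon m\in E\}$. *)

(* Defs.v *)
From mathcomp Require Import all_boot all_order all_algebra.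
From mathcomp Require Import all_classical all_reals topology normedtype sequences.

Set Implicit Arguments.
Unset Strict Implicit.
Unset Printing Implicit Defensive.

Import Order.TTheory GRing.Theory Num.Theory.
Import numFieldNormedType.Exports.

Local Open Scope classical_set_scope.
Local Open Scope ring_scope.

(* The positive integers {1, 2, ...}; their subsets are represented as
   [set nat] included in [posnat]. *)
Definition posnat : set nat := [set n | (0 < n)%N].

(* |E `&` {1, ..., N}| / N; the (junk) term at N = 0 is 0. *)
Definition nat_freq (R : realType) (E : set nat) : R^nat :=
  fun N => (count (mem E) (iota 1 N))%:R / N%:R.

Definition has_nat_density (R : realType) (E : set nat) : Prop :=
  cvgn (nat_freq R E).

(* Only meaningful under [has_nat_density R E]. *)
Definition nat_density (R : realType) (E : set nat) : R :=
  limn (nat_freq R E).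

(* E - n = {m - n : m in E}, keeping only the differences that are >= 0:
   written with k + n rather than m - n to avoid truncated subtraction. *)
Definition shift_left (E : set nat) (n : nat) : set nat :=
  [set k | exists2 m, E m & m = (k + n)%N].

(* Main.v *)
Require Import Defs.
From mathcomp Require Import all_boot all_order all_algebra.
From mathcomp Require Import all_classical all_reals topology normedtype sequences.
From mathcomp Require Import zify ring lra.

Set Implicit Arguments.
Unset Strict Implicit.
Unset Printing Implicit Defensive.

Import Order.TTheory GRing.Theory Num.Theory.
Import numFieldNormedType.Exports.

Local Open Scope classical_set_scope.
Local Open Scope ring_scope.

(** Idea. Cut the integers into words of length [L] and fill them with
    independent fair bits, except that for each [n] about a proportion
    [1 / (2 n (n + 1))] of the positions [i] is coupled with [i + n]: the two
    bits are equal if [n \in S_+], opposite if [n \in S_-].  The correlation at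
    lag [n] then differs from [1/4] by [+- 1 / (8 n (n + 1))] in the limit
    [L -> oo].  Randomness is replaced by listing all possible words, i.e. the
    bits of a position are read off the binary digits of the index of the word;
    this gives a periodic sequence for every [L], and following the [L]-th
    periodic sequence for a time much longer than its period, before passing to
    [L + 1], yields a single sequence realizing all the limits. *)

(** * Sums of periodic sequences *)

Lemma sum_period_shift (V : zmodType) (h : nat -> V) (P t : nat) :
  (forall m, h (m + P)%N = h m) ->
  \sum_(t <= m < t + P) h m = \sum_(0 <= m < P) h m.
Proof.
move=> hper; elim: t => [|t <-]; first by rewrite add0n.
case: P hper => [|P] hper; first by rewrite !addn0 !big_geq.
rewrite addSn [LHS]big_nat_recr /= ?addnS ?ltnS ?leq_addr //.
rewrite [RHS]big_nat_recl ?leq_addr //= addrC.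
by rewrite -[in h _]addnS hper big_add1.
Qed.

Lemma sum_period_mul (V : zmodType) (h : nat -> V) (P k : nat) :
  (forall m, h (m + P)%N = h m) ->
  \sum_(0 <= m < k * P) h m = (\sum_(0 <= m < P) h m) *+ k.
Proof.
move=> hper; rewrite big_nat_mul.
under eq_bigr => i _ do rewrite mulSn addnC sum_period_shift //.
by rewrite sumr_const_nat subn0.
Qed.

(** The two halves of each period [2 * D] cancel; this serves binary digits and block parities
    alike. *)
Lemma sum_antiperiod (V : zmodType) (h : nat -> V) (D k : nat) :
  (forall m, h (m + D)%N = - h m) ->
  \sum_(0 <= m < k * (2 * D)) h m = 0.
Proof.
move=> hanti; have hper m : h (m + 2 * D)%N = h m.
  by rewrite mul2n -addnn addnA !hanti opprK.
rewrite sum_period_mul // mul2n -addnn (@big_cat_nat _ _ _ D) //= ?leq_addr //.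
have -> : \sum_(D <= m < D + D) h m = - \sum_(0 <= m < D) h m.
  rewrite -[D in LHS]add0n big_addn add0n addnK -sumrN.
  by apply: eq_bigr => i _; rewrite hanti.
by rewrite subrr mul0rn.
Qed.

(** Whole periods are removed from the left and contribute 0; at most [P] terms remain, whatever the
    length of the interval. *)
Lemma periodic_sum_le (R : realDomainType) (h : nat -> R) (P t N : nat) :
  (0 < P)%N -> (forall m, h (m + P)%N = h m) ->
  \sum_(0 <= m < P) h m = 0 -> (forall m, `|h m| <= 1) ->
  `|\sum_(t <= m < N) h m| <= P%:R.
Proof.
move=> P0 hper h0 h1.
have [n] := ubnP (N - t)%N; elim: n t => // n IH t ltn.
have [leP|ltP] := leqP (N - t) P.
  apply: (le_trans (ler_norm_sum _ _ _)).
  apply: (@le_trans _ _ (\sum_(t <= m < N) 1)); first exact: ler_sum.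
  by rewrite sumr_const_nat ler_nat.
rewrite (@big_cat_nat _ _ _ (t + P)) /=; [|lia|lia].
by rewrite sum_period_shift // h0 add0r; apply: IH; lia.
Qed.

(** * Gluing periodic words into a generic sequence *)

Definition period_sum (P : nat -> nat) (j : nat) : nat :=
  (\sum_(0 <= i < j.+1) P i)%N.

(* The level [j] is entered only after time [j * period_sum P j], so that all
   periods seen so far are negligible with respect to the elapsed time. *)
Fixpoint level (P : nat -> nat) (m : nat) : nat :=
  if m is k.+1 then
    let j := level P k in
    if (j.+1 * period_sum P j.+1 <= m)%N then j.+1 else j
  else 0%N.

Lemma levelS (P : nat -> nat) (m : nat) :
  level P m.+1 = level P m \/ level P m.+1 = (level P m).+1.
Proof. by rewrite /=; case: ifP; [right|left]. Qed.

Lemma level_mono (P : nat -> nat) : {homo level P : m n / (m <= n)%N}.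
Proof.
apply: homo_leq => //; first by move=> y x z; apply: leq_trans.
by move=> m; case: (levelS P m) => ->.
Qed.

Lemma level_add (P : nat -> nat) (m n : nat) :
  (level P (m + n) <= level P m + n)%N.
Proof.
elim: n => [|n IH]; first by rewrite !addn0.
by rewrite !addnS; case: (levelS P (m + n)) => ->; lia.
Qed.

Lemma level_period_sum_le (P : nat -> nat) (m : nat) :
  (level P m * period_sum P (level P m) <= m)%N.
Proof.
elim: m => //= m IH; case: ifP => // _.
exact: leq_trans IH _.
Qed.

Lemma level_unbounded (P : nat -> nat) (M : nat) :
  exists N, (M <= level P N)%N.
Proof.
elim: M => [|M [N leN]]; first by exists 0%N.
(* At this time the threshold for level [M.+1] is passed, so the level cannot still be [M] one step
   later. *)
pose N' := (N + M.+1 * period_sum P M.+1)%N.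
have leN' : (M <= level P N')%N by apply: leq_trans leN (level_mono _ (leq_addr _ _)).
have [ltM|leM] := ltnP M (level P N'); first by exists N'.
have eqM : level P N' = M by apply/eqP; rewrite eqn_leq leM leN'.
by exists N'.+1 => /=; rewrite eqM; case: ifP => //; rewrite /N'; lia.
Qed.

Lemma level_le_period_sum (P : nat -> nat) (j : nat) :
  (forall i, 0 < P i)%N -> (j.+1 <= period_sum P j)%N.
Proof.
move=> P0; rewrite -[leqLHS]subn0 -[leqLHS]muln1 -sum_nat_const_nat.
exact: leq_sum.
Qed.

(** On a stretch of constant level [j] the sum is at most [P j], however long the stretch; each
    level has a single stretch, so the bounds add up to [period_sum]. *)
Lemma glued_sum_le (R : realDomainType) (P : nat -> nat) (z : nat -> nat -> R)
    (N : nat) :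
  (forall j, 0 < P j)%N -> (forall j m, z j (m + P j)%N = z j m) ->
  (forall j, \sum_(0 <= m < P j) z j m = 0) ->
  (forall j m, `|z j m| <= 1) ->
  `|\sum_(0 <= m < N) z (level P m) m| <= (period_sum P (level P N))%:R.
Proof.
move=> P0 zper z0 z1; set x := fun m => z (level P m) m.
have const_bound t k j : (forall l, (t <= l < k)%N -> level P l = j) ->
    `|\sum_(t <= m < k) x m| <= (P j)%:R.
  move=> lev; rewrite (_ : \sum_(_ <= m < _) _ = \sum_(t <= m < k) z j m).
    exact: periodic_sum_le.
  by apply: eq_big_nat => l /lev; rewrite /x => ->.
have psumS j : period_sum P j.+1 = (period_sum P j + P j.+1)%N.
  by rewrite /period_sum big_nat_recr.
(* [t] is the time at which the current level was entered. *)
have [t [letN lev bnd]] : exists t, [/\ (t <= N)%N,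
    forall l, (t <= l <= N)%N -> level P l = level P N &
    `|\sum_(0 <= m < t) x m| + (P (level P N))%:R
      <= (period_sum P (level P N))%:R].
  elim: N => [|N [t [letN lev bnd]]].
    exists 0%N; split=> // [l|]; first by rewrite leqn0 => /eqP ->.
    by rewrite big_geq // normr0 add0r /period_sum big_nat1.
  case: (levelS P N) => levN.
    exists t; split; [exact: leqW|move=> l|by rewrite levN].
    have [->//|neq] := eqVneq l N.+1.
    by rewrite levN => H; apply: lev; lia.
  (* The level rises: the stretch just ended costs [P (level P N)], already reserved in [bnd]. *)
  exists N.+1; split=> // [l H|]; first by congr level; lia.
  rewrite levN psumS natrD lerD2r; apply: le_trans bnd.
  rewrite (@big_cat_nat _ _ _ t) //=; last exact: leqW.
  apply: (le_trans (ler_normD _ _)); rewrite lerD2l.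
  by apply: const_bound => l H; apply: lev; lia.
rewrite (@big_cat_nat _ _ _ t) //=; apply: (le_trans (ler_normD _ _)).
apply: le_trans bnd; rewrite lerD2l.
by apply: const_bound => l H; apply: lev; lia.
Qed.

Lemma level_cvg (P : nat -> nat) : level P @ \oo --> \oo.
Proof.
move=> A [M _ HA]; have [N leN] := level_unbounded P M.
exists N => // m /= leNm; apply: HA => /=.
exact: leq_trans leN (level_mono _ leNm).
Qed.

(** Bounds the number of [m < N] such that [m] and [m + n] are on different levels. A jump over [n]
    steps is a sum of [n] one-step jumps, and the sum over [m] of each of these telescopes. *)
Lemma sum_level_jump (P : nat -> nat) (n N : nat) :
  (\sum_(0 <= m < N) (level P (m + n) - level P m) <= n * (level P N + n))%N.
Proof.
have mono := @level_mono P.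
elim: n => [|n IH].
  by rewrite big1 // => i _; rewrite addn0 subnn.
rewrite (eq_bigr (fun m => (level P (m + n) - level P m) +
    (level P (m + n).+1 - level P (m + n)))%N); last first.
  move=> i _; have := mono i (i + n)%N (leq_addr _ _).
  by have := mono (i + n)%N (i + n).+1 (leqnSn _); rewrite addnS; lia.
rewrite big_split /= mulSn addnC leq_add //; last first.
  by apply: leq_trans IH _; rewrite leq_mul2l; apply/orP; right; lia.
have -> : (\sum_(0 <= m < N) (level P (m + n).+1 - level P (m + n)) =
    \sum_(0 + n <= m < N + n) (level P m.+1 - level P m))%N.
  by rewrite big_addn addnK.
rewrite telescope_sumn //; apply: leq_trans (leq_subr _ _) _.
by apply: leq_trans (level_add _ _ _) _; rewrite leq_add2l.
Qed.

(** * Frequencies along the glued sequence *)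

Lemma sum_bool_prod_le (R : realDomainType) (a b d : bool) (k : nat) :
  (b = d \/ (0 < k)%N) ->
  `|(a && b)%:R - (a && d)%:R : R| <= k%:R.
Proof.
case=> [->|k0]; first by rewrite subrr normr0.
apply: (@le_trans _ _ 1); last by rewrite (ler_nat _ 1).
by case: a; case: b; case: d; rewrite /= ?subrr ?normr0 ?subr0 ?normr1 // sub0r normrN normr1.
Qed.

(** Sequences are indexed from 0 and integers from 1, so index [m] stands for the integer [m.+1]. *)
Lemma nat_freq_sum (R : realType) (x : nat -> bool) (n N : nat) :
  let E := [set m | (0 < m)%N /\ x m.-1] in
  nat_freq R (E `&` shift_left E n) N =
  (\sum_(0 <= m < N) (x m && x (m + n)%N)%:R) / N%:R.
Proof.
move=> E; rewrite /nat_freq -sum1_count; congr (_ / _).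
rewrite -natr_sum; congr _%:R; rewrite big_mkcond /=.
have -> : iota 1 N = index_iota 1 N.+1 by rewrite /index_iota subn1.
rewrite big_add1 /=; apply: eq_bigr => m _.
have -> : (m.+1 \in E `&` shift_left E n) = x m && x (m + n)%N.
  apply/idP/idP.
    by rewrite inE => -[[_ /= ->]] [k [_ xk] km]; rewrite km /= in xk *.
  move=> /andP[xm xmn]; rewrite inE; split; first by split.
  by exists (m + n).+1; rewrite ?addSn.
by case: (x m && _).
Qed.

(** The correlation sum is compared with the sum of the period means [q (J m)], whose Cesaro
    averages converge to [c n]. Lag 0 gives the density of [E] itself. *)
Lemma generic_sequence (R : realType) (P : nat -> nat) (e : nat -> nat -> bool)
    (c : nat -> R) :
  (forall j, 0 < P j)%N -> (forall j m, e j (m + P j)%N = e j m) ->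
  (forall n, (fun j => (\sum_(0 <= m < P j) (e j m && e j (m + n)%N)%:R)
                         / (P j)%:R) @ \oo --> c n) ->
  exists2 E : set nat, E `<=` posnat &
    forall n, nat_freq R (E `&` shift_left E n) @ \oo --> c n.
Proof.
move=> P0 eper ec; pose x m := e (level P m) m.
pose E := [set m | (0 < m)%N /\ x m.-1].
exists E; first by move=> m [].
move=> n; set J := level P.
pose q j : R := (\sum_(0 <= m < P j) (e j m && e j (m + n)%N)%:R) / (P j)%:R.
pose v N : R := (\sum_(0 <= m < N) q (J m)) / N%:R.
have vc : v @ \oo --> c n.
  rewrite -cvg_shiftS; have qJ : (q \o J) @ \oo --> c n.
    exact: cvg_comp (@level_cvg P) (ec n).
  have := cesaro qJ; rewrite /arithmetic_mean /series /=.
  by under eq_fun do rewrite mulrC.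
have q01 j : 0 <= q j <= 1.
  have Pj : 0 < (P j)%:R :> R by rewrite ltr0n.
  rewrite /q divr_ge0 ?sumr_ge0 ?ler0n //= ler_pdivrMr // mul1r.
  rewrite -natr_sum ler_nat -[leqRHS]subn0 -[leqRHS]muln1 -sum_nat_const_nat.
  by apply: leq_sum => m _; case: (_ && _).
pose z j m : R := (e j m && e j (m + n)%N)%:R - q j.
have zbound N : `|\sum_(0 <= m < N) z (J m) m| <= (period_sum P (J N))%:R.
  apply: glued_sum_le => // j.
  - by move=> m; rewrite /z eper addnAC eper.
  - rewrite /z sumrB sumr_const_nat subn0 -mulr_natr /q divfK ?subrr //.
    by rewrite pnatr_eq0 -lt0n.
  - move=> m; rewrite /z ler_norml.
    by case/andP: (q01 j) => q0 q1; apply/andP; split; case: (_ && _); rewrite /=; lra.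
(* Since [J N < period_sum P (J N)], this [K] absorbs both the [n * (J N + n)] from level jumps and
   the fluctuation bound [zbound]. *)
pose K := (n * n + n + 1)%N.
have bound N : (J N)%:R * `|\sum_(0 <= m < N) (x m && x (m + n)%N)%:R
    - \sum_(0 <= m < N) q (J m)| <= K%:R * N%:R :> R.
  apply: (@le_trans _ _ (((J N) * (K * period_sum P (J N)))%N%:R)); last first.
    rewrite -natrM ler_nat mulnCA leq_mul2l.
    by rewrite level_period_sum_le orbT.
  rewrite natrM ler_wpM2l //.
  (* The bit at [m + n] is first replaced by that of the periodic sequence in use at [m]; what is
     left is the centred periodic term [z]. *)
  rewrite -sumrB (eq_bigr (fun m => ((x m && x (m + n)%N)%:R
     - (x m && e (J m) (m + n)%N)%:R) + z (J m) m)); last first.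
    by move=> m _; rewrite /z /x -/J; ring.
  rewrite big_split /=; apply: (le_trans (ler_normD _ _)).
  apply: (@le_trans _ _ ((n * (J N + n))%N%:R + (period_sum P (J N))%:R)).
    apply: lerD (zbound N); apply: (le_trans (ler_norm_sum _ _ _)).
    apply: (@le_trans _ _ ((\sum_(0 <= m < N) (J (m + n) - J m))%N%:R)).
      rewrite natr_sum; apply: ler_sum => m _; apply: sum_bool_prod_le => //.
      have := @level_mono P _ _ (leq_addr n m); rewrite /x -/J leq_eqVlt.
      by case/orP => [/eqP <-|lt]; [left|right; rewrite subn_gt0].
    by rewrite ler_nat; exact: sum_level_jump.
  rewrite -natrD ler_nat /K; have := level_le_period_sum (J N) P0.
  move: (period_sum P (J N)) => Q JQ; rewrite !mulnDl mul1n mulnDr leq_add2r.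
by rewrite addnC leq_add ?leq_pmulr ?leq_mul2l //; lia.
have err : (fun N => nat_freq R (E `&` shift_left E n) N - v N) @ \oo
    --> (0 : R).
  have J0 : (fun N => K%:R * (J N)%:R^-1) @ \oo --> (0 : R).
    rewrite -[0 in X in _ --> X](mulr0 K%:R); apply: cvgM; first exact: cvg_cst.
    have inv0 : (fun j => j%:R^-1) @ \oo --> (0 : R).
      by rewrite -cvg_shiftS; exact: cvg_harmonic.
    exact: cvg_comp (@level_cvg P) inv0.
  apply: (@squeeze_cvgr _ _ _ _ (fun N => - (K%:R * (J N)%:R^-1))
     (fun N => K%:R * (J N)%:R^-1)) => //; last first.
    by rewrite -oppr0; apply: cvgN.
  have [N0 leN0] := level_unbounded P 1.
  near=> N; rewrite -ler_norml nat_freq_sum /v -mulrBl normrM.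
  have JN : 0 < (J N)%:R :> R.
    rewrite ltr0n; apply: leq_trans leN0 (level_mono _ _).
    by near: N; exact: nbhs_infty_ge.
  have N_gt0 : 0 < N%:R :> R.
    by rewrite ltr0n; near: N; exact: nbhs_infty_gt.
  rewrite [`|_^-1|]ger0_norm ?invr_ge0 ?ler0n // ler_pdivrMr // mulrAC.
  by rewrite ler_pdivlMr // mulrC.
have -> : nat_freq R (E `&` shift_left E n) =
    (fun N => nat_freq R (E `&` shift_left E n) N - v N) \+ v.
  by apply/funext => N /=; rewrite subrK.
by rewrite -[c n]add0r; exact: cvgD err vc.
Unshelve. all: end_near. Qed.

(** * Random words with prescribed sign of each correlation *)

(* The positions [i] with [L %/ n.+1 <= i < L %/ n] are those devoted to lag [n];
   the value is [0], devoted to no lag, for [i >= L]. *)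
Definition lag (L i : nat) : nat := L %/ i.+1.

(* Blocks of length [n] alternate: the position [i] of an odd-numbered block
   copies the position [i - n] of the preceding even-numbered block. *)
Definition paired (L i : nat) : bool :=
  odd (i %/ lag L i) && (lag L (i - lag L i) == lag L i).

(** No chains arise: when [i] is paired, its source has the same lag but lies in an even-numbered
    block, hence is its own source. *)
Definition source (L i : nat) : nat :=
  if paired L i then (i - lag L i)%N else i.

Definition flip (neg : pred nat) (L i : nat) : bool :=
  paired L i && neg (lag L i).

(* The position [m = a * L + i] lies in the [a]-th word, whose free bits are the
   binary digits of [a]. *)
Definition word (neg : pred nat) (L m : nat) : bool :=
  odd (m %/ L %/ 2 ^ source L (m %% L)) (+) flip neg L (m %% L).

Lemma lag_eqE (L i n : nat) : (0 < n)%N ->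
  (lag L i == n) = (L %/ n.+1 <= i < L %/ n)%N.
Proof.
move=> n0; rewrite eqn_leq [(n <= _)%N]leq_divRL // [(i < _)%N]leq_divRL //.
rewrite -[(lag L i <= n)%N]ltnS -[(_ <= i)%N]ltnS !ltn_divLR //.
by rewrite mulnC [(i.+1 * n)%N]mulnC.
Qed.

Lemma source_le (L i : nat) : (source L i <= i)%N.
Proof. by rewrite /source; case: ifP => // _; exact: leq_subr. Qed.

Lemma odd_divnD (i n : nat) : (0 < n)%N -> odd ((i + n) %/ n) = ~~ odd (i %/ n).
Proof. by move=> n0; rewrite divnDr // divnn n0 addn1. Qed.

(** Couplings made for other lags never link two positions at distance [n]: a source has the same
    lag as its copy, so two paired positions with one source would have equal lags and coincide. *)
Lemma source_eqE (L i n : nat) : (0 < n)%N ->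
  (source L i == source L (i + n)) =
  [&& lag L i == n, lag L (i + n) == n & ~~ odd (i %/ n)].
Proof.
move=> n0; apply/eqP/and3P => [|[/eqP li /eqP lin even]]; last first.
  rewrite /source /paired lin addnK li eqxx odd_divnD // even /=.
  by rewrite (negbTE even).
have /negbTE n_neq0 : n != 0%N by rewrite -lt0n.
rewrite {2}/source; case: ifP => [|_ Hs]; last first.
  by have := source_le L i; rewrite Hs; lia.
rewrite /paired; set k := lag L (i + n) => /andP[oddk /eqP lagk].
have lek : (k <= i + n)%N.
  by rewrite leqNgt; apply/negP => /divn_small H; rewrite H in oddk.
rewrite /source; case: ifP => [|_ ik].
  rewrite /paired; set k' := lag L i => /andP[oddk' /eqP lagk'] kk'.
  have lek' : (k' <= i)%N.
    by rewrite leqNgt; apply/negP => /divn_small H; rewrite H in oddk'.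
  have E : k' = k by rewrite -lagk' kk' lagk.
  by exfalso; lia.
have kn : k = n by lia.
move: lagk oddk; rewrite kn addnK odd_divnD // => -> ->.
by rewrite !eqxx.
Qed.

Lemma flip_source_eq (neg : pred nat) (L i n : nat) : (0 < n)%N ->
  source L i = source L (i + n) ->
  flip neg L i (+) flip neg L (i + n) = neg n.
Proof.
move=> n0 /eqP; rewrite source_eqE // => /and3P[/eqP li /eqP lin even].
rewrite /flip /paired lin addnK li eqxx odd_divnD // even.
by rewrite (negbTE even).
Qed.

(** * Averages over all words *)

Lemma odd_divn_exp2D (a p q : nat) : (p < q)%N ->
  odd ((a + 2 ^ q) %/ 2 ^ p) = odd (a %/ 2 ^ p).
Proof.
move=> ltpq; rewrite divnDr ?dvdn_exp2l 1?ltnW // -expnB // 1?ltnW //.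
by rewrite oddD oddX subn_eq0 leqNgt ltpq addbF.
Qed.

(** Sources lie below [L], so the digits of the word index from [L] on are never read. *)
Lemma word_period (neg : pred nat) (L m : nat) : (0 < L)%N ->
  word neg L (m + 2 ^ L * L) = word neg L m.
Proof.
move=> L0; rewrite /word addnC modnMDl divnMDl // addnC odd_divn_exp2D //.
by apply: leq_ltn_trans (source_le _ _) _; rewrite ltn_mod.
Qed.

Lemma sum_sign_bit (R : pzRingType) (p L : nat) : (p < L)%N ->
  \sum_(0 <= a < 2 ^ L) (-1) ^+ odd (a %/ 2 ^ p) = 0 :> R.
Proof.
move=> ltpL.
have -> : (2 ^ L = 2 ^ (L - p.+1) * (2 * 2 ^ p))%N.
  by rewrite -expnS -expnD subnK.
apply: sum_antiperiod => a; rewrite odd_divnD ?expn_gt0 // signrN //.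
Qed.

(** Pairwise independence of the binary digits: for [p < q], adding [2 ^ q] flips digit [q] and
    keeps digit [p]. *)
Lemma sum_sign_bits (R : pzRingType) (p q L : nat) :
  (p < L)%N -> (q < L)%N ->
  \sum_(0 <= a < 2 ^ L) (-1) ^+ (odd (a %/ 2 ^ p) (+) odd (a %/ 2 ^ q))
  = (p == q)%:R * (2 ^ L)%:R :> R.
Proof.
wlog lepq : p q / (p <= q)%N => [H pL qL|pL qL].
  have [/H|/ltnW/H] := leqP p q; first exact.
  by rewrite eq_sym => <- //; apply: eq_bigr => a _; rewrite addbC.
have [<-|neq] := eqVneq p q.
  under eq_bigr => a _ do rewrite addbb.
  by rewrite sumr_const_nat subn0 mul1r.
have ltpq : (p < q)%N by rewrite ltn_neqAle neq.
rewrite mul0r.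
have -> : (2 ^ L = 2 ^ (L - q.+1) * (2 * 2 ^ q))%N.
  by rewrite -expnS -expnD subnK.
apply: sum_antiperiod => a; rewrite odd_divnD ?expn_gt0 // odd_divn_exp2D //.
by rewrite addbN signrN.
Qed.

(** With each bit written as [(1 - sign) / 2], the linear terms average to 0 and the product
    survives only for a shared free bit. The bound on [i + n] keeps both positions in one word. *)
Lemma word_column_sum (R : realFieldType) (neg : pred nat) (L i n : nat) :
  (i + n < L)%N ->
  \sum_(0 <= a < 2 ^ L) (word neg L (a * L + i) && word neg L (a * L + i + n))%:R
  = (2 ^ L)%:R / 4 * (1 + (source L i == source L (i + n))%:R *
      (-1) ^+ (flip neg L i (+) flip neg L (i + n))) :> R.
Proof.
move=> inL; have iL : (i < L)%N by apply: leq_ltn_trans inL; exact: leq_addr.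
have L0 : (0 < L)%N by apply: leq_ltn_trans iL.
have wordE a k : (k < L)%N -> word neg L (a * L + k) =
    odd (a %/ 2 ^ source L k) (+) flip neg L k.
  by move=> kL; rewrite /word divnMDl // modnMDl (divn_small kL) (modn_small kL) addn0.
set u := flip neg L i; set v := flip neg L (i + n).
set p := source L i; set q := source L (i + n).
have pL : (p < L)%N by apply: leq_ltn_trans (source_le _ _) _.
have qL : (q < L)%N by apply: leq_ltn_trans (source_le _ _) _.
rewrite (eq_bigr (fun a => 4^-1 * (1 - (-1) ^+ u * (-1) ^+ odd (a %/ 2 ^ p)
   - (-1) ^+ v * (-1) ^+ odd (a %/ 2 ^ q) + (-1) ^+ (u (+) v) *
     (-1) ^+ (odd (a %/ 2 ^ p) (+) odd (a %/ 2 ^ q))))); last first.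
  move=> a _; rewrite -addnA !wordE // -/u -/v -/p -/q.
  by case: u; case: v; case: (odd _); case: (odd _);
    rewrite /= ?expr0 ?expr1; field.
rewrite -mulr_sumr big_split /= !sumrB -!mulr_sumr.
rewrite !sum_sign_bit // sum_sign_bits // sumr_const_nat subn0.
by field.
Qed.

Lemma word_correlation_mean (R : realFieldType) (neg : pred nat) (L n : nat) :
  (0 < L)%N ->
  (\sum_(0 <= m < 2 ^ L * L) (word neg L m && word neg L (m + n))%:R)
    / (2 ^ L * L)%N%:R
  = (\sum_(0 <= i < L) (\sum_(0 <= a < 2 ^ L)
      (word neg L (a * L + i) && word neg L (a * L + i + n))%:R) / (2 ^ L)%:R)
    / L%:R :> R.
Proof.
move=> L0; rewrite big_nat_mul natrM invfM mulrA; congr (_ / _).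
rewrite -mulr_suml; congr (_ / _); rewrite exchange_big_nat /=.
apply: eq_bigr => a _.
rewrite -[(a * L)%N]add0n big_addn mulSn addnK.
by apply: eq_bigr => i _; rewrite add0n [(i + _)%N]addnC.
Qed.

Lemma word_density (R : realFieldType) (neg : pred nat) (L : nat) : (0 < L)%N ->
  (\sum_(0 <= m < 2 ^ L * L) (word neg L m && word neg L (m + 0))%:R)
    / (2 ^ L * L)%N%:R = 2^-1 :> R.
Proof.
move=> L0; rewrite word_correlation_mean //.
have D0 : (2 ^ L)%:R != 0 :> R by rewrite pnatr_eq0 expn_eq0.
rewrite (eq_big_nat _ _ (F2 := fun=> 2^-1)) => [|i /andP[_ iL]].
  rewrite sumr_const_nat subn0 -[_ *+ L]mulr_natr mulfK // pnatr_eq0.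
  by rewrite -lt0n.
rewrite word_column_sum ?addn0 // eqxx addbb /= expr0.
by rewrite mulr1; field.
Qed.

(** The sources coincide on the even-numbered blocks of an interval of length about
    [L / (n (n + 1)) - n]. Evenness is [1/2 + sign/2], where the signs sum to at most [2 n]; the
    loss of [n] and rounding give the rest of the error. *)
Lemma count_pairs (R : archiRealFieldType) (L n : nat) : (0 < n)%N ->
  `|\sum_(0 <= i < L - n) (source L i == source L (i + n))%:R
     - L%:R / (2 * (n * n.+1)%N%:R)| <= ((3 * n).+1)%:R / 2 :> R.
Proof.
move=> n0; set lo := (L %/ n.+1)%N; set hi := (L %/ n)%N.
have hiL : (hi <= L)%N by exact: leq_div.
have lohi : (lo <= hi)%N by exact: leq_div2l.
have -> : \sum_(0 <= i < L - n) (source L i == source L (i + n))%:R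
    = \sum_(lo <= i < hi - n) (2^-1 + 2^-1 * (-1) ^+ odd (i %/ n)) :> R.
  have [le|lt] := leqP lo (hi - n); last first.
    rewrite [RHS]big_geq; last exact: ltnW.
    rewrite big1 // => i _; rewrite source_eqE // !lag_eqE // -/lo -/hi.
    by case: and3P => // -[] *; exfalso; lia.
  rewrite (@big_cat_nat _ _ _ lo) //=; last by lia.
  rewrite [X in X + _]big1_seq ?add0r; last first.
    move=> i; rewrite mem_index_iota => ilo.
    rewrite source_eqE // !lag_eqE // -/lo -/hi.
    by case: and3P => // -[] *; exfalso; lia.
  rewrite (@big_cat_nat _ _ _ (hi - n)) //=; last by lia.
  rewrite [X in _ + X]big1_seq ?addr0; last first.
    move=> i; rewrite mem_index_iota => ihi.
    rewrite source_eqE // !lag_eqE // -/lo -/hi.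
    by case: and3P => // -[] *; exfalso; lia.
  apply: eq_big_nat => i ilohi; rewrite source_eqE // !lag_eqE // -/lo -/hi.
  have -> : (lo <= i < hi)%N by lia.
  have -> : (lo <= i + n < hi)%N by lia.
  by case: odd; rewrite /= ?expr0 ?expr1; field.
rewrite big_split /= -mulr_sumr sumr_const_nat.
set S := \sum_(_ <= _ < _) _.
have Sle : `|S| <= (2 * n)%N%:R.
  apply: periodic_sum_le => [|m||m]; first by rewrite muln_gt0.
  - by rewrite mul2n -addnn addnA !odd_divnD // negbK.
  - rewrite -[(2 * n)%N]mul1n; apply: sum_antiperiod => m.
    by rewrite odd_divnD // signrN.
  - by rewrite normr_sign.
have floor d : (0 < d)%N ->
    (L %/ d)%N%:R <= (L%:R / d%:R : R) < (L %/ d)%N%:R + 1.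
  move=> d0; have dR : 0 < d%:R :> R by rewrite ltr0n.
  rewrite ler_pdivlMr // ltr_pdivrMr // natr1 -!natrM ler_nat ltr_nat.
  by rewrite leq_trunc_div /= -ltn_divLR.
have /andP[hi1 hi2] := floor _ n0; have /andP[lo1 lo2] := floor n.+1 isT.
rewrite -/hi in hi1 hi2; rewrite -/lo in lo1 lo2.
have nR : 0 < n%:R :> R by rewrite ltr0n.
have -> : L%:R / (2 * (n * n.+1)%N%:R) = 2^-1 * (L%:R / n%:R - L%:R / n.+1%:R)
    :> R.
  rewrite natrM -natr1; field; apply/andP; split; lra.
have len : (hi%:R - lo%:R - n%:R <= (hi - n - lo)%N%:R :> R) /\
           ((hi - n - lo)%N%:R <= hi%:R - lo%:R :> R).
  rewrite -natrB // lerBlDr -natrD !ler_nat; split; lia.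
rewrite -[_ *+ (hi - n - lo)]mulr_natr -[(3 * n).+1%:R]natr1.
case: len; move: Sle hi1 hi2 lo1 lo2; rewrite !ler_norml !natrM.
move: (hi - n - lo)%N%:R => len; move: (L%:R / n%:R) (L%:R / n.+1%:R) => y1 y2.
move: hi%:R lo%:R => hi' lo' /andP[S1 S2] *.
by apply/andP; split; lra.
Qed.

(** Columns [i < L - n] average to [1/4], shifted by [1/4] up or down when the two sources coincide;
    the last [n] columns run into the next word and are merely bounded by 1. *)
Lemma word_correlation (R : archiRealFieldType) (neg : pred nat) (L n : nat) :
  (0 < n <= L)%N ->
  `|(\sum_(0 <= m < 2 ^ L * L) (word neg L m && word neg L (m + n))%:R)
      / (2 ^ L * L)%N%:R
    - (4^-1 + (-1) ^+ neg n / (8 * (n * n.+1)%N%:R))|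
  <= (2 * n).+1%:R / L%:R :> R.
Proof.
move=> /andP[n0 nL]; have L0 : (0 < L)%N by exact: leq_trans nL.
rewrite word_correlation_mean //.
have D0 : 0 < (2 ^ L)%:R :> R by rewrite ltr0n expn_gt0.
have LR : 0 < L%:R :> R by rewrite ltr0n.
pose G i : R := (\sum_(0 <= a < 2 ^ L)
  (word neg L (a * L + i) && word neg L (a * L + i + n))%:R) / (2 ^ L)%:R.
rewrite (eq_bigr G) //.
have G01 i : 0 <= G i <= 1.
  rewrite /G divr_ge0 ?sumr_ge0 ?ler0n //= ler_pdivrMr // mul1r.
  rewrite -natr_sum ler_nat -[leqRHS]subn0 -[leqRHS]muln1 -sum_nat_const_nat.
  by apply: leq_sum => m _; case: (_ && _).
rewrite (@big_cat_nat _ _ _ (L - n)) ?leq_subr //=.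
set tail := \sum_(L - n <= i < L) G i.
have tail_ge0 : 0 <= tail by apply: sumr_ge0 => i _; case/andP: (G01 i).
have tail_len : tail <= n%:R.
  apply: (@le_trans _ _ (\sum_(L - n <= i < L) 1)).
    by apply: ler_sum => i _; case/andP: (G01 i).
  by rewrite sumr_const_nat subKn.
rewrite (eq_big_nat _ _ (F2 := fun i => 4^-1 + 4^-1 * (-1) ^+ neg n *
    (source L i == source L (i + n))%:R)) => [|i iLn]; last first.
  rewrite /G word_column_sum; last by lia.
  have Dn : (2 ^ L)%:R != 0 :> R by rewrite gt_eqF.
  case: eqP => [/flip_source_eq -> //|_]; last by rewrite mul0r mulr0; field.
  by rewrite mul1r mulr1; field.
rewrite big_split /= sumr_const_nat subn0 -mulr_sumr.
have nR : 0 < n%:R :> R by rewrite ltr0n.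
have normL (x : R) : `|x| * L%:R = `|x * L%:R| by rewrite normrM (gtr0_norm LR).
rewrite -[_ *+ (L - n)]mulr_natr natrB // -[(2 * n).+1%:R]natr1.
rewrite [(2 * n)%:R]natrM ler_pdivlMr // normL mulrBl divfK ?gt_eqF // mulrDl.
have := count_pairs R L n0; set A := \sum_(_ <= _ < _) _.
rewrite -[(3 * n).+1%:R]natr1 [(3 * n)%:R]natrM.
set w : R := (n * n.+1)%N%:R.
have -> : L%:R / (2 * w) = 2^-1 * (L%:R / w) by rewrite invfM mulrCA.
have -> : (-1) ^+ neg n / (8 * w) * L%:R = 8^-1 * (-1) ^+ neg n * (L%:R / w).
  by rewrite invfM; ring.
move: (L%:R / w) A => y A; rewrite !ler_norml => /andP[A1 A2].
by case: (neg n); rewrite ?expr0 ?expr1; apply/andP; split; lra.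
Qed.

(** * The set [E] and its correlations *)

Theorem theorem2p8 (R : realType) (Splus Sminus : set nat)
    (hcover : Splus `|` Sminus = posnat)
    (hdisj : Splus `&` Sminus = set0) :
  exists E : set nat,
    [/\ E `<=` posnat,
        has_nat_density R E,
        forall n : nat, (0 < n)%N -> has_nat_density R (E `&` shift_left E n) &
        [/\ forall n : nat, Splus n ->
              nat_density R (E `&` shift_left E n) > nat_density R E ^+ 2,
            forall n : nat, Sminus n ->
              nat_density R (E `&` shift_left E n) < nat_density R E ^+ 2 &
            (fun n : nat => nat_density R (E `&` shift_left E n)) @ \oo
              --> nat_density R E ^+ 2]].
Proof.
pose neg : pred nat := fun n => n \in Sminus.
pose dev n : R := (8 * (n * n.+1)%N%:R)^-1.
(* [c 0] is the density of [E]; its square [1/4] is the baseline at the other lags. *)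
pose c n : R := if n is 0%N then 2^-1 else 4^-1 + (-1) ^+ neg n * dev n.
have dev_gt0 n : (0 < n)%N -> 0 < dev n.
  by move=> n0; rewrite invr_gt0 mulr_gt0 // ltr0n muln_gt0 n0.
have cE n : (0 < n)%N -> c n = 4^-1 + (-1) ^+ neg n * dev n by case: n.
have Splus_gt0 n : Splus n -> (0 < n)%N.
  by move=> Sn; have : posnat n by rewrite -hcover; left.
have Sminus_gt0 n : Sminus n -> (0 < n)%N.
  by move=> Sn; have : posnat n by rewrite -hcover; right.
have [|||E Epos Ec] := @generic_sequence R (fun j => 2 ^ j.+1 * j.+1)%N
    (fun j => word neg j.+1) c.
- by move=> j; rewrite muln_gt0 expn_gt0.
- by move=> j m; exact: word_period.
- case=> [|n]; first by under eq_fun do rewrite word_density //; exact: cvg_cst.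
  set u := fun j => _ / _; rewrite /c.
  have err : (fun j => (2 * n.+1).+1%:R * j.+1%:R^-1) @ \oo --> (0 : R).
    rewrite -[0 in X in _ --> X](mulr0 (2 * n.+1).+1%:R).
    by apply: cvgM; [exact: cvg_cst|exact: cvg_harmonic].
  apply/cvgrPdist_lt => eps eps0.
  move/cvgrPdist_lt : err => /(_ _ eps0) err; near=> j.
  rewrite distrC; apply: le_lt_trans (word_correlation _ _ _) _.
    by rewrite ltnS /=; near: j; exact: nbhs_infty_ge.
  apply: le_lt_trans (ler_norm _) _; rewrite -normrN -[X in `|X|]add0r.
  by near: j.
have EE : E `&` shift_left E 0 = E.
  apply/seteqP; split=> [m []//|m Em]; split=> //.
  by exists m; rewrite ?addn0.
have dE : nat_freq R E @ \oo --> (2^-1 : R) by have := Ec 0%N; rewrite EE.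
have dEn n : nat_density R (E `&` shift_left E n) = c n.
  exact/cvg_lim.
have dEE : nat_density R E ^+ 2 = 4^-1.
  by rewrite /nat_density (cvg_lim _ dE) //; field.
exists E; split=> //.
- by apply/cvg_ex; exists 2^-1.
- by move=> n _; apply/cvg_ex; exists (c n).
rewrite dEE; split.
- move=> n Sn; have n0 := Splus_gt0 _ Sn; rewrite dEn cE //.
  have /negbTE -> : ~~ neg n; last by rewrite expr0 mul1r ltrDl dev_gt0.
  apply/negP; rewrite inE => Sn'.
  by have : (Splus `&` Sminus) n by []; rewrite hdisj.
- move=> n Sn; have n0 := Sminus_gt0 _ Sn; rewrite dEn cE //.
  have -> : neg n by rewrite /neg inE.
  by rewrite expr1 mulN1r gtrDl oppr_lt0 dev_gt0.
under eq_fun do rewrite dEn.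
apply/cvgrPdist_lt => eps eps0.
have := @cvg_harmonic R; move/cvgrPdist_lt => /(_ _ eps0) H.
near=> n; have n0 : (0 < n)%N by near: n; exact: nbhs_infty_gt.
rewrite cE // opprD addrA subrr sub0r normrN normrM normr_sign mul1r.
(* Comparison with the harmonic sequence suffices for (iii). *)
have le : dev n <= n.+1%:R^-1.
  rewrite lef_pV2 ?posrE ?mulr_gt0 ?ltr0n ?muln_gt0 ?n0 //.
  by rewrite -natrM ler_nat; nia.
rewrite gtr0_norm ?dev_gt0 //; apply: le_lt_trans le _.
rewrite -[X in X < _]ger0_norm ?invr_ge0 ?ler0n // -normrN -[X in `|X|]add0r.
by near: n.
Unshelve. all: end_near. Qed.
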